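(* For all positive integers $h$ and $n$ there exists an integer $d=d(h,n)$ such that every finite poset $P$ of height at most $h$ whose cover graph does not contain $K_n$ as a topological minor satisfies $\dim(P)\leq d$.
   Context: All posets are finite. The height of a poset $P$ is the largest $h$ such that there are points $x_1<\cdots<x_h$ in $P$. For distinct points $x,y$, the point $x$ is covered by $y$ in $P$ if $x<y$ in $P$ and there is no $z\in P$ with $x<z<y$ in $P$. The cover graph of $P$ is the undirected graph whose vertices are the points of $P$ and whose edges join $x$ and $y$ whenever one of them is covered by the other. $K_n$ is the complete graph on $n$ vertices. A subdivision of a graph $H$ is a graph $H'$ obtained from $H$ by replacing edges by paths: $H'$ contains all vertices of $H$, each edge $e$ of $H$ corresponds to a path $P_e$ in $H'$ between the endpoints of $e$ whose interior avoids the vertices of $H$, the paths $P_e,P_f$ are internally disjoint for distinct edges $e,f$ of $H$, and $H'$ consists exactly of the vertices of $H$ and these paths. A graph $H$ is a topological minor of $G$ if $G$ contains a subdivision of $H$ as a subgraph. A linear extension of $P$ is a total order $L$ on the points of $P$ such that $x\leq y$ in $P$ implies $x\leq y$ in $L$. The dimension $\dim(P)$ is the least number $d$ of linear extensions $L_1,\ldots,L_d$ of $P$ such that $x\leq y$ in $P$ if and only if $x\leq y$ in $L_i$ for every $i\in\{1,\ldots,d\}$. *)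

(* Defs.v *)
From HB Require Import structures.
From mathcomp Require Import all_boot all_order.

Set Implicit Arguments.
Unset Strict Implicit.
Unset Printing Implicit Defensive.

Import Order.TTheory.

Record sgraph := SGraph {
  vertex :> finType;
  edge : rel vertex;
  edge_sym : symmetric edge;
  edge_irr : irreflexive edge }.

Section CompleteGraph.
Variable n : nat.

Definition complete_edge : rel 'I_n := fun i j => i != j.

Lemma complete_edge_sym : symmetric complete_edge.
Proof. by move=> i j; rewrite /complete_edge eq_sym. Qed.

Lemma complete_edge_irr : irreflexive complete_edge.
Proof. by move=> i; rewrite /complete_edge eqxx. Qed.

Definition complete_graph := SGraph complete_edge_sym complete_edge_irr.

End CompleteGraph.

(* [b] embeds the vertices of [H] in [H'], and [q u v] lists the interior     *)
(* vertices of the path replacing the edge [uv], read from [b u] to [b v];    *)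
(* an undirected edge has the two orientations [(u, v)] and [(v, u)], whence  *)
(* the condition on [rev]. The values of [q] off the edges of [H] are junk.   *)
Definition subdiv_path (H H' : sgraph) (b : H -> H') (q : H -> H -> seq H')
  (u v : H) : seq H' := b u :: rcons (q u v) (b v).

Definition subdivision (H H' : sgraph) : Prop :=
  exists (b : H -> H') (q : H -> H -> seq H'),
  [/\ injective b,
      forall u v : H, edge u v ->
        [/\ q v u = rev (q u v),
            sorted (@edge H') (subdiv_path b q u v),
            uniq (subdiv_path b q u v)
          & forall w : H, b w \notin q u v],
      forall u v u' v' : H, edge u v -> edge u' v' ->
        (u', v') <> (u, v) -> (u', v') <> (v, u) ->
        forall x : H', x \in q u v -> x \notin q u' v',
      forall x : H', (exists u : H, x = b u) \/
        (exists u v : H, edge u v /\ x \in q u v)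
    & forall x y : H', edge x y ->
        exists u v : H, edge u v /\ infix [:: x; y] (subdiv_path b q u v)].

(* Up to isomorphism: the subgraph need not be induced. *)
Definition subgraph (H G : sgraph) : Prop :=
  exists2 f : H -> G, injective f & {homo f : x y / edge x y}.

Definition topological_minor (H G : sgraph) : Prop :=
  exists2 H' : sgraph, subdivision H H' & subgraph H' G.

Section Poset.
Variables (disp : Order.disp_t) (P : finPOrderType disp).
Local Open Scope order_scope.

(* The bound on [h] loses nothing: strict chains have no repetitions. *)
Definition height : nat :=
  (\max_(h < #|P|.+1 | [exists t : h.-tuple P, sorted <%O t]) h)%N.

Definition covered (x y : P) : bool :=
  (x < y) && ~~ [exists z, x < z < y].

Definition cover_edge : rel P := fun x y => covered x y || covered y x.

Lemma cover_edge_sym : symmetric cover_edge.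
Proof. by move=> x y; rewrite /cover_edge orbC. Qed.

Lemma cover_edge_irr : irreflexive cover_edge.
Proof. by move=> x; rewrite /cover_edge /covered ltxx. Qed.

Definition cover_graph := SGraph cover_edge_sym cover_edge_irr.

Definition finrel := {ffun P -> {ffun P -> bool}}.

(* Reflexivity is the case [x = y] of totality. *)
Definition linear_extension (L : finrel) : bool :=
  [&& [forall x, forall y, L x y || L y x],
      [forall x, forall y, L x y && L y x ==> (x == y)],
      [forall x, forall y, forall z, L x y && L y z ==> L x z]
    & [forall x, forall y, (x <= y) ==> L x y]].

Definition realizer (s : seq finrel) : bool :=
  all linear_extension s &&
  [forall x, forall y, (x <= y) == all (fun L : finrel => L x y) s].

(* Key of a linear extension placing [x] above every [y] with [~~ (x <= y)]. *)
Let key (x w : P) : bool *l (nat *l nat) :=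
  (x <= w, (#|[pred z | z <= w]|, enum_rank w : nat)).

Let key_inj x : injective (key x).
Proof. by move=> u v [_ _ /val_inj /enum_rank_inj]. Qed.

Let key_homo x : {homo key x : u v / u <= v}.
Proof.
move=> u v; rewrite le_eqVlt => /predU1P[->|ltuv]; first exact: lexx.
have card_lt : leq #|[pred z | z <= u]|.+1 #|[pred z | z <= v]|.
  apply/proper_card/properP; split.
    by apply/subsetP => z; rewrite !inE => /le_trans; apply; apply: ltW.
  by exists v; rewrite !inE ?lexx// lt_geF.
rewrite /key !Order.ProdLexiOrder.lexi_pair; apply/andP; split.
  by case: (boolP (x <= u)) => // /le_trans -> //; apply: ltW.
by apply/implyP => _; rewrite !leEnat (ltnW card_lt) leqNgt card_lt.
Qed.

Let keyL x : finrel := [ffun u => [ffun v => key x u <= key x v]].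

Let keyL_linear x : linear_extension (keyL x).
Proof.
apply/and4P; split; apply/forallP => u; apply/forallP => v.
- by rewrite !ffunE le_total.
- by rewrite !ffunE; apply/implyP => /le_anti /key_inj ->.
- apply/forallP => w; rewrite !ffunE; apply/implyP => /andP[].
  exact: le_trans.
- by rewrite !ffunE; apply/implyP; apply: key_homo.
Qed.

Lemma realizer_exists :
  exists d : nat, [exists t : d.-tuple finrel, realizer t].
Proof.
exists (size (enum linear_extension)); apply/existsP.
exists (in_tuple (enum linear_extension)); apply/andP; split.
  by apply/allP => L /=; rewrite mem_enum.
apply/forallP => x; apply/forallP => y; apply/eqP.
apply/idP/allP => /= [lexy L|allL].
  by rewrite mem_enum => /and4P[_ _ _ /forallP/(_ x)/forallP/(_ y)/implyP]; apply.
have : keyL x x y by apply: allL; rewrite mem_enum; apply: keyL_linear.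
by rewrite !ffunE /key !Order.ProdLexiOrder.lexi_pair lexx ; case: (x <= y).
Qed.

Definition dim : nat := ex_minn realizer_exists.

End Poset.

(* Main.v *)
Require Import Defs.
From mathcomp Require Import all_boot all_order.
From mathcomp Require Import zify.

(** Bounded dimension comes from weak colourings of the cover graph.

Suppose that the vertices of the cover graph are linearly ordered by [pi] in
such a way that, for a fixed length [r], each vertex weakly [r]-reaches only a
bounded number of vertices, where [x] weakly [r]-reaches [u] if [u] is the
[pi]-least vertex of some walk of length at most [r] from [x] to [u]. A greedy
colouring with boundedly many colours then gives distinct colours to two
vertices whenever one of them weakly [r]-reaches the other ([weak_coloring]).
For [r = 3 * h], such a colouring gives each incomparable pair [(a, b)] a
signature, one of boundedly many, that records, for each colour, whether there
are vertices [u >= a] and [v <= b] of that colour weakly reached along chains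
of covers, and how they compare in [pi]. Pairs with the same signature form no
alternating cycle ([signature_acyclic]): the [pi]-least vertex on the chains
witnessing the comparabilities of the cycle would force an infinite descent in
[pi]. Hence one linear extension reverses all the pairs of a given signature
([reversible]), and the dimension is at most the number of signatures
([dim_signature]).

It remains to find the ordering when no subdivided clique [K_n] is present. By
the theorem of Mader ([dense_has_clique]), neither the graph nor any of its
topological minors is dense, since topological minors compose
([has_model_trans]). Given a nonempty set [S] of vertices, two maximal families
of short disjoint paths provide a vertex [v] of [S] all of whose short paths to
the rest of [S] can be blocked by a bounded number of vertices other than [v]
([small_hitting_set]). Placing such a vertex last and iterating gives the
ordering ([ordering_hit_by_few]). Every walk from [v] to its least vertex
[u <> v] then passes through one of the blocking vertices of [v], from which [u]
is weakly reachable in fewer steps; so the number of weakly reachable vertices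
satisfies a recurrence and is bounded ([weak_reach_bounded]). *)

Set Implicit Arguments.
Unset Strict Implicit.
Unset Printing Implicit Defensive.

Import Order.TTheory.

(** * Topological minors with connecting sets *)

Section Linked.
Variables (T : finType) (e : rel T).

(** The inner vertices of the connecting walk are only required to lie in [A]:
walks concatenate freely, and a simple path is extracted once, at the end. *)
Definition linked (A : {set T}) (x y : T) : Prop :=
  exists2 s : seq T, path e x (rcons s y) & {subset s <= A}.

Lemma linkedS (A B : {set T}) x y : A \subset B -> linked A x y -> linked B x y.
Proof. by move=> /subsetP AB [s ps sA]; exists s => // z /sA /AB. Qed.

Lemma linked_edge (A : {set T}) x y : e x y -> linked A x y.
Proof. by move=> exy; exists [::]; rewrite //= exy. Qed.

Lemma linked_trans (A : {set T}) y x z :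
  y \in A -> linked A x y -> linked A y z -> linked A x z.
Proof.
move=> yA [s ps sA] [t pt tA]; exists (rcons s y ++ t).
  by rewrite rcons_cat cat_path last_rcons ps pt.
by move=> w; rewrite mem_cat mem_rcons inE => /orP[/predU1P[->|/sA]|/tA].
Qed.

End Linked.

(** A subdivision of the graph [(D, g)] inside the vertex set [W] of [(T, e)],
with each subdivided edge represented by a set [Q i j] able to connect its
endpoints rather than by a path. The values of [Q] at the two orientations of
an edge are unrelated, which lets [g] be an asymmetric relation that lists each
edge once. *)
Definition topo_model (I T : finType) (D : {set I}) (g : rel I)
    (W : {set T}) (e : rel T) (f : I -> T) (Q : I -> I -> {set T}) : Prop :=
  [/\ {in D &, injective f} /\ {in D, forall i, f i \in W},
      {in D &, forall i j, g i j -> linked e (Q i j) (f i) (f j)},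
      {in D &, forall i j, g i j -> Q i j \subset W},
      {in D & &, forall i j k, g i j -> f k \notin Q i j}
    & forall i j k l, i \in D -> j \in D -> k \in D -> l \in D ->
        g i j -> g k l -> forall x, x \in Q i j -> x \in Q k l ->
        ((k == i) && (l == j)) || ((k == j) && (l == i))].

Definition has_model (I T : finType) (D : {set I}) (g : rel I)
    (W : {set T}) (e : rel T) : Prop := exists f Q, topo_model D g W e f Q.

(** Topological minors compose. The edge [ij] of the first model becomes a path
of edges [yz] of [h] between vertices of [A i j], so it is connected through
the images of the inner vertices and the sets [R y z]. Distinct edges keep
disjoint sets because an edge of [h] lies in at most one [A i j]: an endpoint
in [Q i j] belongs to no other edge, and if both endpoints are images of
vertices they determine the pair. *)
Lemma has_model_trans (I J T : finType) (D : {set I}) (g : rel I)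
    (V : {set J}) (h : rel J) (W : {set T}) (e : rel T) :
  irreflexive h ->
  has_model D g V h -> has_model V h W e -> has_model D g W e.
Proof.
move=> hirr [f [Q [[finj fV] Ql QV Qf Qd]]] [f' [R [[f'inj f'W] Rl RW Rf Rd]]].
pose A i j := f i |: (f j |: Q i j).
have AV i j : i \in D -> j \in D -> g i j -> {subset A i j <= V}.
  move=> iD jD gij x; rewrite !inE => /or3P[/eqP->|/eqP->|]; rewrite ?fV //.
  by apply/subsetP; apply: QV.
have QA i j : {subset Q i j <= A i j} by move=> u uQ; rewrite !inE uQ !orbT.
pose Q' i j := f' @: Q i j :|:
  \bigcup_(p : J * J | [&& p.1 \in A i j, p.2 \in A i j & h p.1 p.2]) R p.1 p.2.
have inQ' i j x : reflect ((exists2 y, y \in Q i j & x = f' y) \/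
    exists y z, [/\ y \in A i j, z \in A i j, h y z & x \in R y z]) (x \in Q' i j).
  apply: (iffP idP).
    rewrite inE => /orP[/imsetP[y]|/bigcupP[[y z] /= /and3P[]]]; first by left; exists y.
    by right; exists y, z.
  move=> [[y yQ ->]|[y [z [yA zA hyz xR]]]]; rewrite inE ?imset_f //.
  by apply/orP; right; apply/bigcupP; exists (y, z); rewrite //= yA zA hyz.
exists (f' \o f), Q'; split.
- split=> [i j iD jD /= /f'inj|i iD]; last by rewrite /= f'W ?fV.
  by move/(_ (fV _ iD) (fV _ jD)); apply: finj.
- move=> i j iD jD gij /=.
  have [s ps sQ] := Ql _ _ iD jD gij.
  have step y z : y \in A i j -> z \in A i j -> h y z ->
      linked e (Q' i j) (f' y) (f' z).
    move=> yA zA hyz; apply: linkedS (Rl _ _ _ _ hyz); rewrite ?(AV i j) //.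
    by apply/subsetP => x xR; apply/inQ'; right; exists y, z.
  have fiA : f i \in A i j by rewrite !inE eqxx.
  move: ps fiA; move: (f i); elim: s sQ => [|z s IH] sQ y /=.
    rewrite andbT => hy yA; apply: step => //; by rewrite !inE eqxx !orbT.
  move=> /andP[hyz ps] yA.
  have zQ : z \in Q i j by apply: sQ; rewrite mem_head.
  have zA : z \in A i j by rewrite !inE zQ !orbT.
  apply: (@linked_trans _ _ _ (f' z)); first by apply/inQ'; left; exists z.
    exact: step.
  by apply: IH => // w ws; apply: sQ; rewrite inE ws orbT.
- move=> i j iD jD gij; apply/subsetP => x /inQ'[[y yQ ->]|[y [z [yA zA hyz]]]].
    by rewrite f'W // (AV i j) // !inE yQ !orbT.
  by apply/subsetP/RW => //; apply: (AV i j).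
- move=> i j k iD jD kD gij; apply/negP => /=.
  move=> /inQ'[[y yQ /f'inj E]|[y [z [yA zA hyz]]]].
    move: (Qf _ _ _ iD jD kD gij); rewrite E ?yQ ?fV //.
    by apply: (AV i j) => //; apply: QA.
  by apply/negP/Rf; rewrite ?fV // (AV i j).
move=> i j k l iD jD kD lD gij gkl x.
pose goal := (k == i) && (l == j) || (k == j) && (l == i); rewrite -/goal.
have own y : y \in Q i j -> y \in A k l -> goal.
  move=> yij; rewrite !inE => /or3P[/eqP E|/eqP E|]; last exact: (Qd i j k l iD jD kD lD gij gkl y yij).
    by rewrite E (negPf (Qf _ _ _ iD jD kD gij)) in yij.
  by rewrite E (negPf (Qf _ _ _ iD jD lD gij)) in yij.
have own' y : y \in Q k l -> y \in A i j -> goal.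
  move=> ykl; rewrite !inE => /or3P[/eqP E|/eqP E|yij].
  - by rewrite E (negPf (Qf _ _ _ kD lD iD gkl)) in ykl.
  - by rewrite E (negPf (Qf _ _ _ kD lD jD gkl)) in ykl.
  - exact: (Qd i j k l iD jD kD lD gij gkl y).
have shared y z : h y z -> y \in A i j -> z \in A i j ->
    y \in A k l -> z \in A k l -> goal.
  move=> hyz yij zij ykl zkl.
  have yz : y != z by apply: contraTneq hyz => ->; rewrite hirr.
  case: (boolP (y \in Q i j)) => [/own->//|yQ].
  case: (boolP (z \in Q i j)) => [/own->//|zQ].
  case: (boolP (y \in Q k l)) => [/own'->//|yQ'].
  case: (boolP (z \in Q k l)) => [/own'->//|zQ'].
  move: yij zij ykl zkl yz; rewrite !inE (negPf yQ) (negPf zQ) (negPf yQ').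
  rewrite (negPf zQ') !orbF /goal.
  move=> /orP[]/eqP-> /orP[]/eqP->; rewrite ?eqxx // => /orP[]/eqP/finj->//;
    by move=> /orP[]/eqP/finj->; rewrite ?eqxx ?orbT.
move=> /inQ'[[y yQ ->]|[y [z [yA zA hyz xR]]]] /inQ'.
  case=> [[y' yQ' /f'inj E]|[y' [z' [yA' zA' hyz']]]].
    have {}E : y = y' by apply: E; [apply: (AV i j)|apply: (AV k l)] => //; apply: QA.
    by apply: (own y) => //; rewrite E; apply: QA.
  have [y'V z'V yV] : [/\ y' \in V, z' \in V & y \in V].
    by split; [apply: (AV k l)|apply: (AV k l)|apply: (AV i j)] => //; apply: QA.
  by rewrite (negPf (Rf _ _ _ y'V z'V yV hyz')).
case=> [[y' yQ' E]|[y' [z' [yA' zA' hyz' xR']]]].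
  have [yV zV y'V] : [/\ y \in V, z \in V & y' \in V].
    by split; [apply: (AV i j)|apply: (AV i j)|apply: (AV k l)] => //; apply: QA.
  by rewrite E (negPf (Rf _ _ _ yV zV y'V hyz)) in xR.
have [[yV zV] [y'V z'V]] : (y \in V /\ z \in V) /\ (y' \in V /\ z' \in V).
  by split; split; [apply: (AV i j)|apply: (AV i j)|apply: (AV k l)|apply: (AV k l)].
have := Rd _ _ _ _ yV zV y'V z'V hyz hyz' x xR xR'.
by case/orP=> /andP[/eqP E1 /eqP E2]; apply: (shared y z) => //; rewrite -?E1 -?E2.
Qed.

(** * Dense graphs contain subdivided cliques *)

Section Mader.
Variables (T : finType) (h : rel T).
Hypotheses (hsym : symmetric h) (hirr : irreflexive h).

Definition deg (W : {set T}) (x : T) : nat := #|[set y in W | h x y]|.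

Definition arcs (W : {set T}) : nat := \sum_(x in W) deg W x.

Lemma degD1 (W : {set T}) v x : v \in W -> deg W x = h x v + deg (W :\ v) x.
Proof.
move=> vW; rewrite /deg (cardsD1 v) !inE vW /=; congr (_ + _).
by apply: eq_card => y; rewrite !inE andbA.
Qed.

Lemma arcsD1 (W : {set T}) v : v \in W -> arcs W = arcs (W :\ v) + 2 * deg W v.
Proof.
move=> vW; rewrite /arcs (big_setD1 v) //=.
rewrite (eq_bigr (fun x => h x v + deg (W :\ v) x)); last by move=> x _; apply: degD1.
rewrite big_split /=.
suff -> : \sum_(x in W :\ v) h x v = deg W v by lia.
rewrite (degD1 _ vW) hirr add0n /deg -sum1dep_card big_mkcondr.
by apply: eq_bigr => x _; rewrite hsym; case: (h v x).
Qed.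

(** The neighbourhood, in the graph on [W], of the vertex that [U] is contracted
to. *)
Definition outer_nbhd (W U : {set T}) : {set T} :=
  [set x in W :\: U | [exists u in U, h u x]].

Lemma outer_nbhdE W U x :
  (x \in outer_nbhd W U) = (x \in W :\: U) && [exists u in U, h u x].
Proof. by rewrite in_set. Qed.

(** Contraction argument of Mader. While [U] is contracted to one vertex, the
density of the contracted graph, which has [#|W :\: U| + 1] vertices and
[arcs (W :\: U) + 2 * #|N|] arcs for [N] the neighbourhood of [U], is kept at
least [2 * D]. Absorbing into [U] a vertex of [N] with fewer than [D]
neighbours in [N] destroys at most [2 * D] arcs and one vertex, so [U] can grow
until [N] itself has minimum degree at least [D], or until [N] is empty, and
then [W :\: U] is a smaller dense set. *)
Lemma dense_linked_subset (D : nat) (W : {set T}) :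
  0 < D -> W != set0 -> 2 * D * #|W| <= arcs W ->
  exists U N : {set T}, [/\ N != set0, N \subset W, U \subset W, [disjoint U & N] &
    D * #|N| <= arcs N /\ {in N &, forall x y, linked h U x y}].
Proof.
move=> D0; have [k] := ubnP #|W|; elim: k W => // k IHk W ltWk Wn0 dense.
(* Only linkage between neighbours of [U] is recorded about the connectedness
   of [U]. *)
suff main (U : {set T}) : U \subset W -> U != set0 ->
    (forall x y, [exists u in U, h u x] -> [exists u in U, h u y] -> linked h U x y) ->
    2 * D * (#|W :\: U|).+1 <= arcs (W :\: U) + 2 * #|outer_nbhd W U| ->
    exists U N : {set T}, [/\ N != set0, N \subset W, U \subset W, [disjoint U & N] &
      D * #|N| <= arcs N /\ {in N &, forall x y, linked h U x y}].
  have /set0Pn[v vW] := Wn0.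
  apply: (main [set v]); first by rewrite sub1set.
  - by apply/set0Pn; exists v; rewrite inE.
  - move=> x y /existsP[_ /andP[/set1P-> hvx]] /existsP[_ /andP[/set1P-> hvy]].
    exists [:: v]; first by rewrite /= hsym hvx hvy.
    by move=> z; rewrite !inE.
  - suff -> : #|outer_nbhd W [set v]| = deg W v.
      by rewrite -arcsD1 // (cardsD1 v W) vW add1n in dense *.
    apply: eq_card => x; rewrite !inE andbC.
    have -> : [exists u in [set v], h u x] = h v x.
      apply/existsP/idP => [[_ /andP[/set1P-> ]]//|hvx].
      by exists v; rewrite inE eqxx.
    by case: eqVneq => [->|_]; rewrite ?hirr ?andbF //= andbC.
have [m] := ubnP #|W :\: U|; elim: m U => // m IHm U ltUm UW Un0 joined dens.
set N := outer_nbhd W U.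
have NWU : N \subset W :\: U by apply/subsetP => x; rewrite inE => /andP[].
have [N0|Nn0] := eqVneq N set0.
  rewrite -/N N0 cards0 in dens.
  have ltWU : #|W :\: U| < #|W|.
    apply: proper_card; rewrite properE subsetDl /=.
    have /set0Pn[u uU] := Un0; apply/subsetPn; exists u; first exact: (subsetP UW).
    by rewrite inE uU.
  have [|||U' [N' [N'n0 N'W U'W dis dN']]] := IHk (W :\: U); first by lia.
  - apply: contraTneq dens => ->; rewrite /arcs big_set0 cards0; lia.
  - lia.
  exists U', N'; split=> //; first exact: subset_trans N'W (subsetDl _ _).
  exact: subset_trans U'W (subsetDl _ _).
have [/existsP[v /andP[vN degv]]|/existsPn alldeg] := boolP [exists v in N, deg N v < D].
  have [vWU hUv] : v \in W :\: U /\ [exists u in U, h u v]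
    by move: vN; rewrite in_set => /andP[].
  have [vW vU] : v \in W /\ v \notin U by move: vWU; rewrite inE => /andP[].
  have WvU : W :\: (v |: U) = (W :\: U) :\ v.
    by apply/setP => x; rewrite !inE negb_or andbA.
  apply: (IHm (v |: U)).
  - by move: ltUm; rewrite WvU (cardsD1 v) vWU; lia.
  - by rewrite subUset sub1set vW.
  - by apply/set0Pn; exists v; rewrite !inE eqxx.
  - have sU : U \subset v |: U by apply: subsetUr.
    have vvU : v \in v |: U by rewrite !inE eqxx.
    have adj x : [exists u in v |: U, h u x] -> [exists u in U, h u x] \/ h v x.
      case/existsP => u /andP[]; rewrite inE => /orP[/set1P->|uU] hux; first by right.
      by left; apply/existsP; exists u; rewrite uU.
    have tov x : [exists u in U, h u x] -> linked h (v |: U) x v.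
      by move=> hx; apply: linkedS sU _; apply: joined.
    have fromv x : [exists u in U, h u x] -> linked h (v |: U) v x.
      by move=> hx; apply: linkedS sU _; apply: joined.
    move=> x y /adj[hx|hx] /adj[hy|hy].
    + by apply: linkedS sU _; apply: joined.
    + apply: (linked_trans vvU (tov _ hx)); exact: linked_edge.
    + by apply: (linked_trans vvU _ (fromv _ hy)); apply: linked_edge; rewrite hsym.
    + by apply: (@linked_trans _ _ _ v) => //; apply: linked_edge; rewrite // hsym.
  - rewrite WvU.
    have sub : (N :\ v) :|: [set y in (W :\: U) :\: N | h v y] \subset outer_nbhd W (v |: U).
      apply/subsetP => x; rewrite in_setU in_setD1 !outer_nbhdE WvU in_setD1.
      rewrite [x \in [set _ in _ | _]]in_set [x \in _ :\: N]in_setD.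
      case/orP => [/and3P[xv xWU /existsP[u /andP[uU hux]]]|/andP[/andP[_ xWU] hvx]].
        by rewrite xv xWU; apply/existsP; exists u; rewrite in_setU uU orbT.
      rewrite xWU andbT; apply/andP; split.
        by apply: contraTneq hvx => ->; rewrite hirr.
      by apply/existsP; exists v; rewrite !inE eqxx.
    have := subset_leq_card sub; rewrite cardsU.
    have -> : (N :\ v) :&: [set y in (W :\: U) :\: N | h v y] = set0.
      apply/setP => y; rewrite in_setI in_setD1 [y \in [set _ in _ | _]]in_set.
      by rewrite [y \in _ :\: N]in_setD in_set0; case: (y \in N); rewrite ?andbF.
    rewrite cards0.
    have dsplit : deg (W :\: U) v = deg N v + #|[set y in (W :\: U) :\: N | h v y]|.
      rewrite /deg -(cardsID N [set y in W :\: U | h v y]); congr (_ + _).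
        apply: eq_card => y; rewrite in_setI ![y \in [set _ in _ | _]]in_set.
        by case: (y \in W :\: U) => //=; rewrite andbC.
      apply: eq_card => y; rewrite -[N]/(outer_nbhd W U) !in_setD.
      rewrite [LHS]andbC [RHS]in_set /= in_setD.
      by rewrite [y \in [set _ in _ | _]]in_set in_setD; case: (y \in N); rewrite ?andbF // !andbT.
    have := arcsD1 vWU; have := cardsD1 v (W :\: U); have := cardsD1 v N.
    rewrite vN vWU -/N in dens *; nia.
exists U, N; split => //.
- by apply: subset_trans NWU _; apply: subsetDl.
- by rewrite disjoints_subset; apply/subsetP => x xU; rewrite !inE xU.
- split; last by move=> x y; rewrite !inE => /andP[_ hx] /andP[_ hy]; apply: joined.
  rewrite /arcs mulnC -sum_nat_const; apply: leq_sum => x xN.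
  by have := alldeg x; rewrite xN /= -leqNgt.
Qed.

Lemma arcs_card (W : {set T}) n : W != set0 -> n * #|W| <= arcs W -> n <= #|W|.
Proof.
move=> Wn0 dense; rewrite -(@leq_pmul2r #|W|) ?card_gt0 //.
apply: leq_trans dense _; rewrite -sum_nat_const /arcs; apply: leq_sum => x _.
by apply: subset_leq_card; apply/subsetP => y; rewrite inE => /andP[].
Qed.

(** Each edge of the model costs a factor [2] of density: one edge [i0 j0] is
left out, the others are found inside a dense set [N] whose vertices are linked
through a disjoint [U], and [U] then serves as the set of [i0 j0]. *)
Lemma dense_has_model n (F : seq ('I_n * 'I_n)) (W : {set T}) :
  0 < n -> W != set0 -> n * 2 ^ size F * #|W| <= arcs W ->
  has_model setT (fun i j => (i, j) \in F) W h.
Proof.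
move=> n0; elim: F W => [|[i0 j0] F IH] W Wn0 /= dense.
  have nW : n <= #|W| by apply: arcs_card Wn0 _; rewrite muln1 in dense.
  exists (fun i => enum_val (widen_ord nW i)), (fun _ _ => set0).
  split=> //; split=> [i j _ _ /enum_val_inj [] /val_inj //|i _]; exact: enum_valP.
have [||U [N [Nn0 NW UW dis [dN joined]]]] := @dense_linked_subset (n * 2 ^ size F) W _ Wn0.
- by rewrite muln_gt0 n0 expn_gt0.
- by rewrite mulnCA -expnS.
have [f [Q [[finj fN] Ql QN Qf Qd]]] := IH N Nn0 dN.
pose Q' i j := if (i == i0) && (j == j0) then U else Q i j.
have disU x : x \in U -> x \in N -> False.
  by move=> xU xN; move/pred0P/(_ x): dis; rewrite /= xU xN.
have QW i j : (i, j) \in F -> {subset Q i j <= N}.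
  by move=> ijF; apply/subsetP/QN.
have inF i j : (i, j) \in (i0, j0) :: F -> (i == i0) && (j == j0) = false -> (i, j) \in F.
  by rewrite inE xpair_eqE => /orP[->|].
exists f, Q'; rewrite /Q'; split.
- by split=> // i iT; apply: (subsetP NW); apply: fN.
- move=> i j _ _ ijF; case: ifP => [_|/(inF _ _ ijF)]; last exact: Ql.
  by apply: joined; apply: fN.
- move=> i j _ _ ijF; case: ifP => [_ //|/(inF _ _ ijF) ij].
  by apply: subset_trans NW; apply: QN.
- move=> i j k _ _ _ ijF; case: ifP => [_|/(inF _ _ ijF)]; last exact: Qf.
  by apply/negP => /disU; apply; apply: fN.
- move=> i j k l _ _ _ _ ijF klF x.
  case: ifP => [/andP[/eqP-> /eqP->]|/(inF _ _ ijF) ij]; case: ifP => [kl|/(inF _ _ klF) kl].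
  + by move=> _ _; apply/orP; left.
  + by move=> xU xQ; case: (disU x xU (QW _ _ kl x xQ)).
  + by move=> xQ xU; case: (disU x xU (QW _ _ ij x xQ)).
  + exact: Qd.
Qed.

(** The exponent only needs to exceed the number of edges of the clique. *)
Definition clique_density (n : nat) : nat := n * 2 ^ (n * n).

Definition has_clique n (W : {set T}) : Prop :=
  has_model [set: 'I_n] (fun i j => i < j) W h.

Lemma dense_has_clique n (W : {set T}) :
  0 < n -> W != set0 -> clique_density n * #|W| <= arcs W -> has_clique n W.
Proof.
move=> n0 Wn0 dense.
pose F := enum [set p : 'I_n * 'I_n | p.1 < p.2].
have leF : size F <= n * n.
  by rewrite -cardE (leq_trans (max_card _)) // card_prod card_ord.
have [|f [Q [? Ql QW Qf Qd]]] := @dense_has_model n F W n0 Wn0.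
  apply: leq_trans dense; rewrite leq_mul2r leq_mul2l leq_exp2l ?leF ?orbT //.
have FE (i j : 'I_n) : i < j -> (i, j) \in F by rewrite mem_enum inE.
exists f, Q; split=> //.
- by move=> i j ? ? /FE; apply: Ql.
- by move=> i j ? ? /FE; apply: QW.
- by move=> i j k ? ? ? /FE; apply: Qf.
- by move=> i j k l ? ? ? ? /FE ij /FE kl; apply: Qd.
Qed.

End Mader.

(** * Maximal families of short paths *)

(** Sparseness of every subset makes [h] degenerate; the greedy choice of a
vertex of degree less than [t], whose closed neighbourhood is then discarded,
keeps one vertex out of every [t]. *)
Lemma sparse_independent (T : finType) (h : rel T) t (A : {set T}) :
  symmetric h -> irreflexive h ->
  (forall W : {set T}, W \subset A -> W != set0 -> arcs h W < t * #|W|) ->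
  exists I : {set T}, [/\ I \subset A, {in I &, forall x y, ~~ h x y} & #|A| <= t * #|I|].
Proof.
move=> hsym hirr; have [k] := ubnP #|A|; elim: k A => // k IH A ltAk sparse.
have [->|An0] := eqVneq A set0.
  by exists set0; split; rewrite ?sub0set ?cards0 // => x y; rewrite inE.
have /existsP[v /andP[vA degv]] : [exists v in A, deg h A v < t].
  apply: contraTT (sparse A (subxx _) An0) => /existsPn large.
  rewrite -leqNgt mulnC -sum_nat_const; apply: leq_sum => x xA.
  by have := large x; rewrite xA /= -leqNgt.
pose N := [set y in A | h v y]; pose A' := A :\: (v |: N).
have A'A : A' \subset A by apply: subsetDl.
have cardA : #|A| <= t + #|A'|.
  have NA : v |: N \subset A.
    by rewrite subUset sub1set vA; apply/subsetP => y; rewrite inE => /andP[].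
  rewrite -(cardsID (v |: N) A) leq_add2r (setIidPr NA).
  by apply: leq_trans (leq_card_setU _ _).1 _; rewrite cards1.
have ltA' : #|A'| < k.
  apply: leq_trans (_ : #|A| <= k); last by lia.
  by apply: proper_card; rewrite properE A'A; apply/subsetPn; exists v; rewrite ?inE ?eqxx.
have [I [IA' indep cardI]] := IH A' ltA' (fun W WA' => sparse W (subset_trans WA' A'A)).
have Ifar x : x \in I -> ~~ h v x.
  move=> /(subsetP IA'); rewrite !inE negb_or => /andP[/andP[_ nN] xA].
  by move: nN; rewrite xA.
have vI : v \notin I by apply/negP => /(subsetP IA'); rewrite !inE eqxx.
exists (v |: I); split.
- by rewrite subUset sub1set vA (subset_trans IA').
- move=> x y; rewrite !inE => /predU1P[->|xI] /predU1P[->|yI].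
  + by rewrite hirr.
  + exact: Ifar.
  + by rewrite hsym Ifar.
  + exact: indep.
- by rewrite cardsU1 vI; lia.
Qed.

Section Families.
Variables (T : finType) (e : rel T).
Hypothesis e_sym : symmetric e.

Lemma path_rev_rcons x s y : path e x (rcons s y) = path e y (rcons (rev s) x).
Proof.
have := rev_path e x (rcons s y); rewrite last_rcons belast_rcons rev_cons => ->.
by apply: eq_path => a b; rewrite e_sym.
Qed.

(** A topological minor [h] on the ground set [A] of [(T, e)], realised by
internally disjoint paths with fewer than [r] inner vertices, all outside [A];
[ok] restricts the pairs that may be joined. *)
Definition path_family (A : {set T}) (ok : rel T) (r : nat) (h : rel T)
    (Q : T -> T -> seq T) : Prop :=
  [/\ symmetric h,
      forall x y, h x y -> [/\ x \in A, y \in A, x != y & ok x y],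
      forall x y, h x y -> Q y x = rev (Q x y),
      forall x y, h x y ->
        [/\ path e x (rcons (Q x y) y), size (Q x y) < r & all (mem (~: A)) (Q x y)]
    & forall x y x' y', h x y -> h x' y' -> forall z, z \in Q x y -> z \in Q x' y' ->
        ((x' == x) && (y' == y)) || ((x' == y) && (y' == x))].

Definition maximal_family (A : {set T}) (ok : rel T) (r : nat) (h : rel T)
    (Q : T -> T -> seq T) : Prop :=
  forall x y s, x \in A -> y \in A -> x != y -> ok x y ->
    path e x (rcons s y) -> size s < r -> all (mem (~: A)) s ->
    (forall x' y', h x' y' -> ~~ has (mem (Q x' y')) s) -> h x y.

Lemma family_add A ok r h Q x y s :
  symmetric ok -> path_family A ok r h Q ->
  x \in A -> y \in A -> x != y -> ok x y ->
  path e x (rcons s y) -> size s < r -> all (mem (~: A)) s ->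
  (forall x' y', h x' y' -> ~~ has (mem (Q x' y')) s) -> ~~ h x y ->
  path_family A ok r (fun a b => [|| h a b, (a == x) && (b == y) | (a == y) && (b == x)])
    (fun a b => if (a == x) && (b == y) then s else
                if (a == y) && (b == x) then rev s else Q a b).
Proof.
move=> oksym [hsym hA Qrev Qpath Qdisj] xA yA xy okxy ps szs sA fresh nhxy.
have yx : (y == x) = false by rewrite eq_sym (negPf xy).
have nhyx : ~~ h y x by rewrite hsym.
have dis a b z : h a b -> z \in s -> z \in Q a b -> False.
  by move=> hab zs zQ; case/hasP: (fresh _ _ hab); exists z.
split.
- by move=> a b; rewrite hsym; congr (_ || _); rewrite orbC; congr (_ || _); apply: andbC.
- move=> a b /or3P[/hA //|/andP[/eqP-> /eqP->]|/andP[/eqP-> /eqP->]]; split=> //.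
    by rewrite yx.
  by rewrite oksym.
- move=> a b /or3P[hab|/andP[/eqP-> /eqP->]|/andP[/eqP-> /eqP->]].
  + have hba : h b a by rewrite hsym.
    case: ifP => [/andP[/eqP E1 /eqP E2]|_]; first by rewrite -E1 -E2 hba in nhxy.
    case: ifP => [/andP[/eqP E1 /eqP E2]|_]; first by rewrite -E1 -E2 hab in nhxy.
    case: ifP => [/andP[/eqP E1 /eqP E2]|_]; first by rewrite -E1 -E2 hab in nhxy.
    case: ifP => [/andP[/eqP E1 /eqP E2]|_]; first by rewrite -E1 -E2 hba in nhxy.
    exact: Qrev.
  + by rewrite yx !eqxx.
  + by rewrite yx !eqxx revK.
- move=> a b /or3P[hab|/andP[/eqP-> /eqP->]|/andP[/eqP-> /eqP->]].
  + have hba : h b a by rewrite hsym.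
    case: ifP => [/andP[/eqP E1 /eqP E2]|_]; first by rewrite -E1 -E2 hab in nhxy.
    case: ifP => [/andP[/eqP E1 /eqP E2]|_]; first by rewrite -E1 -E2 hba in nhxy.
    exact: Qpath.
  + by rewrite !eqxx.
  + by rewrite yx !eqxx /= -path_rev_rcons size_rev all_rev.
- move=> a b a' b' hab ha'b' z.
  have new c d : [|| h c d, (c == x) && (d == y) | (c == y) && (d == x)] ->
     z \in (if (c == x) && (d == y) then s else
            if (c == y) && (d == x) then rev s else Q c d) ->
     (h c d /\ z \in Q c d) \/
     (((c == x) && (d == y)) || ((c == y) && (d == x)) /\ z \in s).
    case: ifP => [_ _ zs|_]; first by right.
    case: ifP => [_ _ |_]; first by rewrite mem_rev; right.
    by rewrite !orbF => ? ?; left.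
  move=> /(new _ _ hab) {hab} zab /(new _ _ ha'b') {ha'b'} zab'.
  case: zab zab' => [[hab zQ]|[E zs]] [[hab' zQ']|[E' zs']].
  + exact: Qdisj hab hab' z zQ zQ'.
  + by case: (dis _ _ _ hab zs' zQ).
  + by case: (dis _ _ _ hab' zs zQ').
  + case/orP: E => /andP[/eqP-> /eqP->]; first exact: E'.
    by rewrite orbC.
Qed.

Lemma max_family (A : {set T}) (ok : rel T) (r : nat) :
  symmetric ok -> exists h Q, path_family A ok r h Q /\ maximal_family A ok r h Q.
Proof.
move=> oksym.
suff ext h Q : path_family A ok r h Q ->
    exists h Q, path_family A ok r h Q /\ maximal_family A ok r h Q.
  by apply: (ext (fun _ _ => false) (fun _ _ => [::])); split.
have [k] := ubnP #|[set p : T * T | ~~ h p.1 p.2]|.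
elim: k h Q => // k IH h Q ltk famQ.
pose bad (x y : T) (s : r.-bseq T) :=
  [&& [&& x \in A, y \in A, x != y & ok x y], path e x (rcons s y), size s < r,
    all (mem (~: A)) s, [forall x', forall y', h x' y' ==> ~~ has (mem (Q x' y')) s]
    & ~~ h x y].
have [/existsP[x /existsP[y /existsP[s]]]|nobad] :=
    boolP [exists x, exists y, exists s, bad x y s].
  case/and5P=> /and4P[xA yA xy okxy] ps szs sA /andP[/forallP fresh nh].
  have {}fresh x' y' : h x' y' -> ~~ has (mem (Q x' y')) s.
    by move: (fresh x') => /forallP/(_ y')/implyP.
  apply: IH (family_add oksym famQ xA yA xy okxy ps szs sA fresh nh).
  apply: leq_trans (_ : #|[set p : T * T | ~~ h p.1 p.2]| <= k); last by lia.
  apply: proper_card; rewrite properE; apply/andP; split.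
    by apply/subsetP => p; rewrite !inE negb_or => /andP[].
  by apply/subsetPn; exists (x, y); rewrite !inE //= !eqxx orbT.
exists h, Q; split=> // x y s xA yA xy okxy ps szs sA fresh.
apply: contraR nobad => nh; apply/existsP; exists x; apply/existsP; exists y.
apply/existsP; exists (Bseq (ltnW szs)); rewrite /bad xA yA xy okxy ps szs sA nh /= andbT.
by apply/forallP => x'; apply/forallP => y'; apply/implyP => /fresh.
Qed.

Section FamilyTheory.
Variables (A : {set T}) (ok : rel T) (r : nat) (h : rel T) (Q : T -> T -> seq T).
Hypothesis famQ : path_family A ok r h Q.

Lemma family_irr : irreflexive h.
Proof.
by case: famQ => _ hA _ _ _ x; apply/negP => /hA[_ _]; rewrite eqxx.
Qed.

Lemma family_model (W : {set T}) : W \subset A -> has_model W h setT e.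
Proof.
case: famQ => hsym hA Qrev Qpath Qdisj WA.
exists id, (fun x y => [set z in Q x y]); split=> //.
- by split.
- move=> x y _ _ /Qpath[ps _ _]; exists (Q x y) => // z zQ; by rewrite inE.
- move=> x y z _ _ /(subsetP WA) zA /Qpath[_ _ /allP QA]; rewrite inE.
  by apply/negP => /QA; rewrite !inE zA.
- move=> x y x' y' _ _ _ _ hxy hxy' z; rewrite !inE; exact: Qdisj.
Qed.

(** Clique subdivisions in [h] compose with the paths of the family to clique
subdivisions in [e], so excluding the latter bounds the density of [h]. *)
Lemma family_sparse n (W : {set T}) :
  0 < n -> ~ has_clique e n setT -> W \subset A -> W != set0 ->
  arcs h W < clique_density n * #|W|.
Proof.
move=> n0 noK WA Wn0; rewrite ltnNge; apply/negP => dense; apply: noK.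
case: (famQ) => hsym _ _ _ _.
apply: has_model_trans (family_model WA); first exact: family_irr.
by apply: dense_has_clique dense => //; apply: family_irr.
Qed.

Lemma family_interior :
  #|\bigcup_(p : T * T | [&& p.1 \in A, p.2 \in A & h p.1 p.2]) [set z in Q p.1 p.2]|
    <= r * arcs h A.
Proof.
case: famQ => _ _ _ Qpath _.
apply: (@leq_trans (\sum_(p : T * T | [&& p.1 \in A, p.2 \in A & h p.1 p.2]) r)).
  elim/big_rec2: _ => [|p m X /and3P[_ _ /Qpath[_ /ltnW sz _]] le]; first by rewrite cards0.
  rewrite (leq_trans (leq_card_setU _ _).1) // leq_add // (leq_trans _ sz) //.
  by rewrite cardsE card_size.
rewrite sum_nat_const mulnC leq_mul2l; apply/orP; right.
rewrite -sum1_card /arcs (eq_bigr (fun x => \sum_(y in A | h x y) 1)); last first.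
  by move=> x _; rewrite sum1dep_card.
rewrite pair_big_dep /=; apply/eq_leq/eq_bigl => -[x y] //.
Qed.

End FamilyTheory.
End Families.

(** * Orderings in which short descents are easy to block *)

Lemma split_first (T : Type) (p : pred T) (s : seq T) : has p s ->
  exists a w b, [/\ s = a ++ w :: b, p w & ~~ has p a].
Proof.
elim: s => //= x s IH; have [px _|npx /= /IH [a [w [b [-> pw npa]]]]] := boolP (p x).
  by exists [::], x, s.
by exists (x :: a), w, b; rewrite /= negb_or npx npa.
Qed.

Lemma path_mid (T : Type) (e : rel T) x a w b :
  path e x (a ++ w :: b) = path e x (rcons a w) && path e w b.
Proof. by rewrite cat_path rcons_path /= andbA. Qed.

Definition hit_bound (n r : nat) : nat :=
  r * clique_density n * (1 + 2 * r * clique_density n) * clique_density n.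

Section Ordering.
Variables (T : finType) (e : rel T) (n r : nat).
Hypotheses (e_sym : symmetric e) (n0 : 0 < n) (noK : ~ has_clique e n setT).

(** A first maximal family joins vertices of [S] by paths of length at most
[2 * r]; its graph [h1] is sparse, so it has a large independent set [I] and the
set [X] of inner vertices has size linear in that of [S]. A second maximal
family joins vertices of [I] to vertices of [M = S :|: X] outside [I]; its
graph [h2] is sparse too, and as [M] is only a bounded factor larger than [I],
some [v] in [I] has bounded degree in [h2]. The neighbours of [v] in [h2] and
the paths to them form the hitting set. Indeed, follow a short path from [v] to
its first vertex [w] in [M]. If it met a path of the second family starting at
another vertex of [I], or if [w] were in [I], two vertices of [I] would be
joined by a path of length at most [2 * r] avoiding [X], against the maximality
of the first family and the independence of [I]; otherwise, by maximality of
the second family, [vw] is an edge of [h2] or the path meets one that starts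
at [v]. *)
Lemma small_hitting_set (S : {set T}) : S != set0 ->
  exists v (Z : {set T}), [/\ v \in S, #|Z| <= hit_bound n r, v \notin Z &
    forall s y, y \in S -> y != v -> path e v (rcons s y) -> size s < r ->
      all (mem (~: S)) s -> has (mem Z) (rcons s y)].
Proof.
move=> Sn0; have [t tE] : exists t, t = clique_density n by exists (clique_density n).
have [//|h1 [Q1 [fam1 max1]]] := @max_family _ _ e_sym S (fun _ _ => true) (2 * r).
have [h1sym h1A Q1rev Q1path _] := fam1.
have sparse1 (W : {set T}) : W \subset S -> W != set0 -> arcs h1 W < t * #|W|.
  by rewrite tE; exact: (family_sparse fam1 n0 noK).
have [I [IS indep cardS]] := sparse_independent h1sym (family_irr fam1) sparse1.
pose X := \bigcup_(p : T * T | [&& p.1 \in S, p.2 \in S & h1 p.1 p.2]) [set z in Q1 p.1 p.2].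
have cardX : #|X| <= 2 * r * arcs h1 S := family_interior fam1.
pose M := S :|: X.
pose ok2 : rel T := fun x y => (x \in I) != (y \in I).
have ok2sym : symmetric ok2 by move=> x y; rewrite /ok2 eq_sym.
have [h2 [Q2 [fam2 max2]]] := max_family e_sym M r ok2sym.
have [h2sym h2A Q2rev Q2path _] := fam2.
have SM : S \subset M := subsetUl _ _.
have Mn0 : M != set0.
  by have /set0Pn[x xS] := Sn0; apply/set0Pn; exists x; apply: (subsetP SM).
have sparse2 : arcs h2 M < t * #|M|.
  by rewrite tE; exact: (family_sparse fam2 n0 noK (subxx _) Mn0).
pose Z v := \bigcup_(w in [set w in M | h2 v w]) [set z in w :: Q2 v w].
have cardZ v : #|Z v| <= r * deg h2 M v.
  rewrite mulnC -sum_nat_const /Z.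
  elim/big_rec2: _ => [|w m Y]; first by rewrite cards0.
  rewrite inE => /andP[_ /Q2path[_ sz _]] le.
  rewrite (leq_trans (leq_card_setU _ _).1) // leq_add // (leq_trans _ sz) //.
  by rewrite cardsE (leq_trans (card_size _)).
have /existsP[v /andP[vI degv]] : [exists v in I, r * deg h2 M v <= hit_bound n r].
  have [//|/existsPn large] := boolP [exists v in I, r * deg h2 M v <= hit_bound n r].
  have le1 : #|I| * (hit_bound n r).+1 <= r * arcs h2 M.
    rewrite -sum_nat_const /arcs big_distrr /=.
    apply: (@leq_trans (\sum_(v in I) r * deg h2 M v)).
      by apply: leq_sum => v vI; have := large v; rewrite vI /= -ltnNge.
    have IM : I \subset M := subset_trans IS SM.
    rewrite [leqRHS](bigID (mem I)) /= -[leqLHS]addn0 leq_add //.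
    rewrite [leqRHS](eq_bigl (mem I)) // => x /=.
    by case: (boolP (x \in I)) => [/(subsetP IM) ->|]; rewrite ?andbF.
  have cardM : #|M| <= #|S| + #|X| := (leq_card_setU _ _).1.
  have := sparse1 S (subxx _) Sn0; have S0 : 0 < #|S| by rewrite card_gt0.
  have I0 : 0 < #|I| by move: cardS S0; case: #|I| => //; lia.
  move=> /ltnW arcS.
  have leX : #|X| <= 2 * r * t * #|S|.
    by apply: leq_trans cardX _; rewrite -(mulnA (2 * r)) leq_mul2l arcS orbT.
  have leM : #|M| <= (1 + 2 * r * t) * #|S| by lia.
  have leM' : #|M| <= (1 + 2 * r * t) * (t * #|I|).
    by apply: leq_trans leM _; rewrite leq_mul2l cardS orbT.
  have : #|I| * (hit_bound n r).+1 <= r * t * ((1 + 2 * r * t) * (t * #|I|)).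
    apply: leq_trans le1 _; rewrite -mulnA leq_mul2l; apply/orP; right.
    by apply: leq_trans (ltnW sparse2) _; rewrite leq_mul2l leM' orbT.
  have -> : r * t * ((1 + 2 * r * t) * (t * #|I|)) = #|I| * hit_bound n r.
    by rewrite /hit_bound -tE !mulnA mulnC !mulnA.
  by rewrite leq_mul2l ltnn orbF -leqn0 leqNgt I0.
have vS : v \in S := subsetP IS v vI.
exists v, (Z v); split=> //.
- exact: leq_trans (cardZ v) degv.
- apply/negP => /bigcupP[w]; rewrite inE => /andP[_ hvw]; rewrite !inE => /predU1P[E|vQ].
    by have [_ _] := h2A _ _ hvw; rewrite E eqxx.
  have [_ _ /allP/(_ _ vQ)] := Q2path _ _ hvw.
  by rewrite /= in_setC (subsetP SM).
move=> s y yS yv ps szs sS.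
have [a [w [b [Es wM aM]]]] : exists a w b,
    [/\ rcons s y = a ++ w :: b, w \in M & ~~ has (mem M) a].
  by apply: split_first; rewrite has_rcons /= (subsetP SM).
have sza : size a < r.
  have /eqP := congr1 size Es; rewrite size_rcons size_cat addnS eqSS => /eqP Esz.
  by apply: leq_ltn_trans szs; rewrite Esz leq_addr.
have pa : path e v (rcons a w) by move: ps; rewrite Es path_mid => /andP[].
have aM' : all (mem (~: M)) a.
  by apply/allP => z za /=; rewrite inE; apply: contra aM => zM; apply/hasP; exists z.
(* Such a path would extend the first family, as it avoids [X], whereas [I] is
   independent in [h1]. *)
have outM u c : path e v (rcons c u) -> size c < 2 * r -> all (mem (~: M)) c ->
    u \in I -> u != v -> False.
  move=> pc szc cM uI uv.
  have : h1 v u.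
    apply: (max1 v u c) => //.
    - exact: subsetP IS u uI.
    - by rewrite eq_sym.
    - by apply/allP => z /(allP cM); rewrite !inE negb_or => /andP[].
    - move=> x' y' hxy; apply/hasPn => z /(allP cM) /=; rewrite !inE negb_or.
      case/andP=> _; apply: contra => zQ; apply/bigcupP; exists (x', y').
        by have [-> -> _ _] := h1A _ _ hxy.
      by rewrite inE.
  by apply/negP; apply: indep.
have wv : w != v.
  have : w \in rcons s y by rewrite Es mem_cat mem_head orbT.
  rewrite mem_rcons inE => /predU1P[->//|/(allP sS)]; rewrite /= inE.
  by apply: contraNneq => ->.
have wI : w \notin I by apply/negP => wI; apply: (outM w a) => //; apply: leq_trans sza _; rewrite leq_pmull.
have inZ w' z : h2 v w' -> (z == w') || (z \in Q2 v w') -> z \in rcons s y ->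
    has (mem (Z v)) (rcons s y).
  move=> hvw zw zs; apply/hasP; exists z => //; apply/bigcupP; exists w'.
    by rewrite inE hvw andbT; have [] := h2A _ _ hvw.
  by rewrite !inE.
have as_ z : z \in a -> z \in rcons s y by rewrite Es mem_cat => ->.
have [hvw|nhvw] := boolP (h2 v w).
  by apply: (inZ w w); rewrite // ?eqxx // Es mem_cat mem_head orbT.
(* The segment of [a] up to [z] followed by the path of the second family back
   to its endpoint in [I] has fewer than [2 * r] inner vertices. *)
suff [x' [y' [z [hxy xI za zQ]]]] : exists x' y' z,
    [/\ h2 x' y', x' \in I, z \in a & z \in Q2 x' y'].
  have [E|xv] := eqVneq x' v; first by apply: (inZ y' z); rewrite -?E ?zQ ?orbT ?as_.
  have [a1 [a2 Ea]] : exists a1 a2, a = a1 ++ z :: a2.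
    by case/splitPr: za => a1 a2; exists a1, a2.
  have [q1 [q2 Eq]] : exists a1 a2, Q2 x' y' = a1 ++ z :: a2.
    by case/splitPr: zQ => b1 b2; exists b1, b2.
  have [pq szq qM] := Q2path _ _ hxy.
  case: (outM x' (rcons a1 z ++ rev q1)) => //.
  - move: pa; rewrite Ea -cats1 -catA path_mid => /andP[pz _].
    rewrite rcons_cat cat_path pz last_rcons -path_rev_rcons //.
    by move: pq; rewrite Eq -cats1 -catA path_mid => /andP[].
  - rewrite size_cat size_rcons size_rev.
    move: sza szq; rewrite Ea Eq !size_cat /= !addnS mulSn mul1n => sza szq.
    rewrite -addnS; apply: leq_add; last by rewrite (leq_trans _ szq) // !ltnS leqW ?leq_addr.
    by rewrite (leq_trans _ sza) // leqW // ltnS leq_addr.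
  - rewrite all_cat all_rev all_rcons.
    move: aM' qM; rewrite Ea Eq !all_cat /= => /and3P[-> -> _] /andP[-> _].
    by [].
have /existsP[x' /existsP[y' /andP[hxy /hasP[z za zQ]]]] :
    [exists x', exists y', h2 x' y' && has (mem (Q2 x' y')) a].
  apply: contraNT nhvw => /existsPn none.
  apply: (max2 v w a) => //; first exact: subsetP SM v vS.
  - by rewrite eq_sym.
  - by rewrite /ok2 vI (negPf wI).
  - move=> x' y' hxy; apply: contra (none x') => hit.
    by apply/existsP; exists y'; rewrite hxy.
have [_ _ _] := h2A _ _ hxy; rewrite /ok2.
case: (boolP (x' \in I)) => [xI _|_]; first by exists x', y', z.
case: (boolP (y' \in I)) => // yI _; exists y', x', z; split=> //; first by rewrite h2sym.
by rewrite (Q2rev _ _ hxy) mem_rev.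
Qed.

(** All paths of bounded length descending from [v] in the order [pi] to their
first lower vertex can be blocked by few vertices other than [v]. *)
Definition hit_by_few (pi : T -> nat) (K : nat) (v : T) : Prop :=
  exists Z : {set T}, [/\ #|Z| <= K, v \notin Z &
    forall s y, path e v (rcons s y) -> size s < r -> pi y < pi v ->
      all (fun z => pi v < pi z) s -> has (mem Z) (rcons s y)].

(** Vertices are ranked from the last to the first: among the set [S] of vertices
still unranked, a vertex with a small hitting set receives the largest available
rank, so the vertices ranked above it are exactly those outside [S]. *)
Lemma ordering_hit_by_few : exists pi : T -> nat,
  injective pi /\ forall v, hit_by_few pi (hit_bound n r) v.
Proof.
suff main k (S : {set T}) : #|S| = k -> exists pi : T -> nat,
    [/\ {in S &, injective pi}, forall x, (pi x < k) = (x \in S) &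
        {in S, forall v, hit_by_few pi (hit_bound n r) v}].
  have [pi [inj _ good]] := main _ [set: T] erefl.
  by exists pi; split=> [x y|v]; [apply: inj|apply: good].
elim: k S => [|k IH] S cardS.
  have S0 : S = set0 by apply/eqP; rewrite -cards_eq0 cardS.
  by exists (fun=> 0); split=> [x|x|x]; rewrite S0 inE.
have [|v [Z [vS cZ vZ hitZ]]] := @small_hitting_set S.
  by rewrite -card_gt0 cardS.
have [|pi [inj bnd good]] := IH (S :\ v).
  by move: cardS; rewrite (cardsD1 v) vS => -[].
pose pi' x := if x == v then k else if x \in S then pi x else k.+1.
have low x : x \in S -> x != v -> pi' x = pi x /\ pi x < k.
  by move=> xS xv; rewrite /pi' (negPf xv) xS bnd !inE xv.
have bnd' x : (pi' x < k.+1) = (x \in S).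
  rewrite /pi'; case: eqVneq => [->|xv]; first by rewrite vS leqnn.
  by case: ifP => xS; [have [_ /ltnW] := low _ xS xv | rewrite ltnn].
have piv : pi' v = k by rewrite /pi' eqxx.
exists pi'; split=> //.
  move=> x y xS yS.
  have [->|xv] := eqVneq x v; have [->|yv] := eqVneq y v => //.
  - by rewrite piv; have [-> lt] := low _ yS yv => E; rewrite E ltnn in lt.
  - by rewrite piv; have [-> lt] := low _ xS xv => E; rewrite E ltnn in lt.
  - have [-> _] := low _ xS xv; have [-> _] := low _ yS yv.
    by apply: inj; rewrite !inE ?xv ?yv.
move=> u uS; have [->|uv] := eqVneq u v.
  exists Z; split=> // s y ps szs ltyv sv; apply: hitZ => //.
  - by rewrite -bnd' (ltn_trans ltyv) // piv.
  - by apply: contraTneq ltyv => ->; rewrite ltnn.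
  - by apply/allP => z /(allP sv); rewrite /= inE -bnd' piv -leqNgt.
have [|Z' [cZ' uZ' hitZ']] := good u; first by rewrite !inE uv.
have [Eu ltu] := low _ uS uv.
exists Z'; split=> // s y ps szs; rewrite Eu => ltyu su; apply: hitZ' => //.
  have yS : y \in S by rewrite -bnd'; lia.
  have yv : y != v by apply: contraTneq ltyu => ->; rewrite piv; lia.
  by have [<-] := low _ yS yv.
apply/allP => z /(allP su); have [->|zv] := eqVneq z v.
  have := bnd v; rewrite !inE eqxx /=; lia.
have [zS|zS] := boolP (z \in S); first by have [->] := low _ zS zv.
by have := bnd z; rewrite !inE (negPf zS) andbF; lia.
Qed.

End Ordering.

(** * Weak colourings *)

(** The recurrence satisfied by the number of vertices weakly reachable in [k]
steps, when [K] vertices are enough to block every descent. *)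
Fixpoint reach_bound (K k : nat) : nat :=
  if k is k'.+1 then (K * reach_bound K k').+1 else 1.

Section WeakReach.
Variables (T : finType) (e : rel T) (pi : T -> nat).

(** When [m = pi y], the vertex [y] is the lowest of the walk: it is then weakly
[k]-reachable from [x]. *)
Definition high_walk (m k : nat) (x y : T) : Prop :=
  exists s, [/\ path e x s, last x s = y, size s <= k & all (fun z => m <= pi z) (x :: s)].

Lemma high_walkW m m' k k' x y :
  m' <= m -> k <= k' -> high_walk m k x y -> high_walk m' k' x y.
Proof.
move=> lem lek [s [ps ls szs ms]]; exists s; split=> //; first exact: leq_trans lek.
by apply/allP => z /(allP ms); apply: leq_trans.
Qed.

Lemma high_walk_cat m k l x y z :
  high_walk m k x y -> high_walk m l y z -> high_walk m (k + l) x z.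
Proof.
move=> [s [ps ls szs ms]] [t [pt lt szt mt]]; exists (s ++ t); split.
- by rewrite cat_path ps ls.
- by rewrite last_cat ls.
- by rewrite size_cat leq_add.
- by rewrite -cat_cons all_cat ms; case/andP: mt.
Qed.

Lemma high_walk_sym m k x y : symmetric e -> high_walk m k x y -> high_walk m k y x.
Proof.
move=> e_sym [s [ps ls szs ms]]; exists (rev (belast x s)); split.
- by rewrite -ls rev_path (eq_path (e' := e)) // => a b; rewrite e_sym.
- by case: s ls {ps szs ms} => [//|z s] /= _; rewrite rev_cons last_rcons.
- by rewrite size_rev size_belast.
- apply/allP => z; rewrite -ls -rev_rcons -lastI mem_rev; exact: (allP ms).
Qed.

(** A walk from [v] to a lower vertex [u], minimal on the walk, starts with a
descent from [v] to the first vertex below [v]. The descent meets the hitting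
set of [v] at some [z], and from [z] on the walk is shorter, so [u] is weakly
reachable from [z] in one step less. *)
Lemma weak_reach_bounded K r k v : injective pi -> (forall v, hit_by_few e r pi K v) ->
  k <= r -> exists B : {set T}, #|B| <= reach_bound K k /\
    forall u, high_walk (pi u) k v u -> u \in B.
Proof.
move=> inj hit; elim: k v => [|k IH] v lekr.
  exists [set v]; rewrite cards1; split=> // u [[|z s] [_ ls // _ _]].
  by rewrite inE -ls.
have /fin_all_exists[B HB] := IH^~ (ltnW lekr).
have [Z [cZ vZ hitZ]] := hit v.
exists (v |: \bigcup_(z in Z) B z); split=> [|u [s [ps ls szs ms]]].
  apply: leq_trans (leq_card_setU _ _).1 _; rewrite cards1 /= ltnS.
  apply: (@leq_trans (#|Z| * reach_bound K k)); last by rewrite leq_mul2r cZ orbT.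
  rewrite -sum_nat_const; elim/big_rec2: _ => [|z m Y _ le]; first by rewrite cards0.
  by apply: leq_trans (leq_card_setU _ _).1 _; rewrite leq_add ?(HB z).1.
rewrite !inE; have [//|uv /=] := eqVneq u v.
(* Without loops, the walk does not return to [v]. *)
have [t [pt lt vt szt ut]] : exists t, [/\ path e v t, last v t = u, v \notin t,
    size t <= k.+1 & all (fun z => pi u <= pi z) (v :: t)].
  case/shortenP: ps ls => t pt /= /andP[vt unt] sub lt; exists t; split=> //.
    exact: leq_trans (uniq_leq_size unt sub) szs.
  case/andP: ms => uv' /allP ms.
  by rewrite /= uv' /=; apply/allP => z /sub /ms.
have ltuv : pi u < pi v.
  by case/andP: (ut) => leuv _; rewrite ltn_neqAle (inj_eq inj) uv.
have ut' : u \in t.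
  by rewrite -lt; case: t lt {pt vt szt ut} => [/esym/eqP|z t _]; rewrite ?(negPf uv) //= mem_last.
have [a [y [b [Et lty na]]]] : exists a y b,
    [/\ t = a ++ y :: b, pi y < pi v & ~~ has (fun z => pi z < pi v) a].
  by apply: split_first; apply/hasP; exists u.
have /hasP[z] : has (mem Z) (rcons a y).
  apply: hitZ => //.
  - by move: pt; rewrite Et path_mid => /andP[].
  - move: szt; rewrite Et size_cat /= addnS ltnS => szt.
    by apply: leq_ltn_trans lekr; apply: leq_trans szt; apply: leq_addr.
  - apply/allP => z za; rewrite ltn_neqAle (inj_eq inj) leqNgt.
    apply/andP; split; last by apply: contra na => lz; apply/hasP; exists z.
    by apply: contraNneq vt => ->; rewrite Et mem_cat za.
move=> zs zZ; apply/bigcupP; exists z => //; apply: (HB z).2.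
have [a1 [a2 Ea]] : exists a1 a2, rcons a y = a1 ++ z :: a2.
  by case/splitPr: zs => a1 a2; exists a1, a2.
have {}Et : t = a1 ++ z :: (a2 ++ b) by rewrite Et -cat_rcons Ea -catA.
exists (a2 ++ b); split.
- by move: pt; rewrite Et path_mid => /andP[].
- by move: lt; rewrite Et last_cat.
- by move: szt; rewrite Et size_cat /= addnS ltnS; apply: leq_trans; apply: leq_addl.
- by move: ut; rewrite Et /= all_cat => /and3P[].
Qed.

Lemma greedy_coloring c (B : T -> {set T}) :
  injective pi -> (forall v, #|B v| <= c) ->
  exists phi : T -> 'I_c.+1, forall v u, u \in B v -> pi u < pi v -> phi u != phi v.
Proof.
move=> inj cB.
suff main k : exists phi : T -> 'I_c.+1,
    forall v u, pi v < k -> u \in B v -> pi u < pi v -> phi u != phi v.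
  have [phi col] := main (\max_v pi v).+1; exists phi => v u.
  by apply: col; rewrite ltnS leq_bigmax.
elim: k => [|k [phi col]]; first by exists (fun=> ord0).
have [/existsP[v0 /eqP v0k]|/existsPn none] := boolP [exists v, pi v == k]; last first.
  exists phi => v u; rewrite ltnS leq_eqVlt (negPf (none v)); exact: col.
have /subsetPn[a _ aB] : ~~ ([set: 'I_c.+1] \subset phi @: B v0).
  apply/negP => /subset_leq_card; rewrite cardsT card_ord leqNgt ltnS.
  by rewrite (leq_trans (leq_imset_card _ _) (cB v0)).
exists (fun x => if x == v0 then a else phi x) => v u ltv uB ltuv.
have uv0 : u != v0 by apply: contraTneq ltuv => ->; lia.
rewrite (negPf uv0); have [E|vv0] := eqVneq v v0.
  by apply: contraNneq aB => <-; rewrite imset_f // -E.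
apply: col => //; rewrite ltn_neqAle -ltnS ltv andbT -v0k (inj_eq inj) //.
Qed.

End WeakReach.

Definition color_bound (n r : nat) : nat := (reach_bound (hit_bound n r) r).+1.

(** Greedy colouring along [pi] separates each vertex from the vertices weakly
reachable from it. In the symmetric form of the conclusion, one need not know
which end of the walk is the lower one. *)
Lemma weak_coloring (T : finType) (e : rel T) n r :
  symmetric e -> 0 < n -> ~ has_clique e n setT ->
  exists (pi : T -> nat) (phi : T -> 'I_(color_bound n r)),
    injective pi /\ forall u v, phi u = phi v ->
      high_walk e pi (minn (pi u) (pi v)) r u v -> u = v.
Proof.
move=> e_sym n0 noK; have [pi [inj hit]] := ordering_hit_by_few r e_sym n0 noK.
have /fin_all_exists[B HB] := fun v => weak_reach_bounded v inj hit (leqnn r).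
have [phi col] := greedy_coloring inj (fun v => (HB v).1).
have main u v : pi u < pi v -> phi u = phi v ->
    high_walk e pi (minn (pi u) (pi v)) r u v -> False.
  move=> ltuv Ephi hw.
  suff uB : u \in B v by have := col v u uB ltuv; rewrite Ephi eqxx.
  apply: (HB v).2; apply: high_walk_sym => //.
  by move: hw; rewrite (minn_idPl (ltnW ltuv)).
exists pi, phi; split=> // u v Ephi hw.
have [lt|lt|/inj //] := ltngtP (pi u) (pi v); first by case: (main u v).
case: (main v u lt (esym Ephi)); rewrite minnC; exact: high_walk_sym.
Qed.

(** * Dimension of posets with a weakly coloured cover graph *)

Section PosetDim.
Variables (disp : Order.disp_t) (P : finPOrderType disp).
Local Open Scope order_scope.

Lemma covered_connect (x y : P) : x <= y -> connect (@covered _ P) x y.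
Proof.
have [k] := ubnP #|[pred z | x < z < y]|; elim: k x y => // k IH x y ltk.
rewrite le_eqVlt => /predU1P[->|ltxy]; first exact: connect0.
have [/existsP[z /andP[xz zy]]|nz] := boolP [exists z, x < z < y]; last first.
  by apply: connect1; rewrite /covered ltxy.
apply: (connect_trans (y := z)); apply: IH; rewrite ?ltW //.
  apply: leq_trans (_ : (#|[pred z | (x < z < y)%O]| <= k)%N); last by rewrite -ltnS.
  apply/proper_card/properP; split; last by exists z; rewrite !inE ?xz ?zy ?ltxx ?andbF.
  by apply/subsetP => w; rewrite !inE => /andP[-> wz]; apply: lt_trans wz zy.
apply: leq_trans (_ : (#|[pred z | (x < z < y)%O]| <= k)%N); last by rewrite -ltnS.
apply/proper_card/properP; split; last by exists z; rewrite !inE ?xz ?zy ?ltxx ?andbF.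
by apply/subsetP => w; rewrite !inE => /andP[zw ->]; rewrite (lt_trans xz zw).
Qed.

Lemma covered_path_height (x : P) s : path (@covered _ P) x s -> (size s < height P)%N.
Proof.
move=> ps; have lt_s : sorted <%O (x :: s).
  by apply: sub_path ps => u v /andP[].
have szs : (size (x :: s) < #|P|.+1)%N.
  rewrite ltnS -(card_uniqP (sorted_uniq lt_trans ltxx lt_s)); exact: max_card.
apply: (@leq_bigmax_cond _ _ (fun i : 'I_#|P|.+1 => i : nat) (Ordinal szs)).
by apply/existsP; exists (in_tuple (x :: s)).
Qed.

(** If the pairs of [C] form no alternating cycle, the order of [P] together with
the reversed pairs of [C] generates a partial order, because a cycle in this
relation reads as an alternating cycle. Comparing first the sizes of principal
ideals, with ties broken by an enumeration, extends it to a total order. *)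
Lemma reversible (C : pred (P * P)) :
  (forall s, s != [::] -> all C s -> ~~ cycle (fun p q => p.1 <= q.2) s) ->
  exists L : finrel P, linear_extension L /\ forall p, C p -> L p.2 p.1.
Proof.
move=> acyclic; pose R : rel P := fun x y => (x <= y) || C (y, x).
have pathR x s : path R x s -> path <=%O x s \/
    exists p t, [/\ all C (p :: t), path (fun p q => p.1 <= q.2) p t,
      x <= p.2 & (last p t).1 <= last x s].
  elim: s x => [|z s IH] x /=; first by left.
  case/andP=> /orP[xz|Czx] /IH[ps|[p [t [Cp pt zp lt]]]].
  - by left; rewrite xz.
  - by right; exists p, t; split=> //; apply: le_trans xz zp.
  - right; exists (z, x), [::]; split; rewrite //= ?Czx //.
    elim: s z ps {IH Czx} => //= w s IH z /andP[zw /IH]; exact: le_trans.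
  - by right; exists (z, x), (p :: t); split; rewrite //= ?Czx ?zp.
have anti x y : connect R x y -> connect R y x -> x = y.
  move=> /connectP[s ps ->] /connectP[t pt Et].
  have /pathR[] : path R x (s ++ t) by rewrite cat_path ps.
    have le_last u r : path <=%O u r -> u <= last u r.
      by elim: r u => //= w r IH u /andP[uw /IH]; apply: le_trans.
    rewrite cat_path => /andP[/le_last le1 /le_last]; rewrite -Et => le2.
    by apply/le_anti; rewrite le1.
  case=> p [r [Cr pr xp lr]]; have := acyclic (p :: r) isT Cr.
  by rewrite /= rcons_path pr (le_trans lr) // last_cat -Et.
pose f x := #|[pred z | connect R z x]|.
have f_lt x y : connect R x y -> x != y -> (f x < f y)%N.
  move=> xy nxy; apply/proper_card/properP; split.
    by apply/subsetP => z; rewrite !inE => /connect_trans; apply.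
  exists y; rewrite !inE ?connect0 //; apply: contra nxy => yx.
  by rewrite (anti x y).
pose L : finrel P := [ffun x => [ffun y =>
  (f x < f y)%N || (f x == f y) && (enum_rank x <= enum_rank y)%N]].
have RL x y : connect R x y -> L x y.
  rewrite !ffunE; have [-> _|nxy /f_lt->//] := eqVneq x y.
  by rewrite eqxx leqnn orbT.
exists L; split; last first.
  by case=> a b Cab; apply: RL; apply: connect1; rewrite /R Cab orbT.
apply/and4P; split; apply/forallP => x; apply/forallP => y.
- by rewrite !ffunE; move: (f x) (f y) => m n; lia.
- rewrite !ffunE; apply/implyP => le2; apply/eqP/enum_rank_inj/val_inj => /=.
  by case: ltngtP le2 => //= _ /anti_leq.
- apply/forallP => z; rewrite !ffunE; apply/implyP.
  by move: (f x) (f y) (f z) => m n p; lia.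
- by apply/implyP => xy; apply: RL; apply: connect1; rewrite /R xy.
Qed.

(** One linear extension per signature, reversing all incomparable pairs with
that signature. *)
Lemma dim_signature (S : finType) (sig : P * P -> S) :
  (forall sg s, s != [::] -> all (fun p => ~~ (p.1 <= p.2) && (sig p == sg)) s ->
     ~~ cycle (fun p q => p.1 <= q.2) s) ->
  (dim P <= #|S|)%N.
Proof.
move=> acyclic; have /fin_all_exists[L HL] := fun sg => reversible (acyclic sg).
rewrite /dim; case: ex_minnP => d _; apply.
have sz : size [seq L sg | sg <- enum S] == #|S| by rewrite size_map -cardE.
apply/existsP; exists (Tuple sz); apply/andP; split.
  by apply/allP => _ /mapP[sg _ ->]; case: (HL sg).
apply/forallP => x; apply/forallP => y; apply/eqP; apply/idP/allP => /= [xy _ /mapP[sg _ ->]|allL].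
  by have [/and4P[_ _ _ /forallP/(_ x)/forallP/(_ y)/implyP/(_ xy)]] := HL sg.
apply: contraT => nxy; have [/and4P[_ anti _ _] rev] := HL (sig (x, y)).
have Lyx := rev (x, y); rewrite /= nxy eqxx in Lyx.
have Lxy : L (sig (x, y)) x y by apply: allL; apply: map_f; rewrite mem_enum.
move: anti => /forallP/(_ x)/forallP/(_ y)/implyP; rewrite Lxy Lyx // => /(_ isT)/eqP E.
by rewrite E lexx in nxy.
Qed.

Section Signature.
Variables (h c : nat) (pi : P -> nat) (phi : P -> 'I_c).
Hypotheses (hP : (height P <= h)%N) (pi_inj : injective pi).
Hypothesis col : forall u v, phi u = phi v ->
  high_walk (@cover_edge _ P) pi (minn (pi u) (pi v)) (h + h + h) u v -> u = v.

(** [climb (pi u) a u] says that [u] is above [a] and is the [pi]-least vertex of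
some chain of covers from [a] to [u]; dually for [climb (pi v) v b]. Such a
vertex [u] is determined by [a] and its colour, and [v] by [b] and its colour. *)
Definition climb (m : nat) (x y : P) : bool :=
  (m <= pi x)%N &&
  connect [rel z w | [&& covered z w, m <= pi z & m <= pi w]%N] x y.

Lemma climb_walk m x y : climb m x y -> high_walk (@cover_edge _ P) pi m h x y.
Proof.
case/andP=> mx /connectP[s ps ->]; exists s; split=> //.
- by apply: sub_path ps => u v /= /and3P[cuv _ _]; rewrite /cover_edge cuv.
- apply: leq_trans hP; apply/ltnW/(@covered_path_height x).
  by apply: sub_path ps => u v /= /and3P[].
- by rewrite /= mx /=; elim: s x mx ps => //= z s IH x mx /andP[/and3P[_ _ mz] /(IH _ mz)->]; rewrite mz.
Qed.

Lemma climb_le m x y : climb m x y -> x <= y.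
Proof.
case/andP=> _ /connectP[s ps ->]; elim: s x ps => //= z s IH x.
by case/andP=> /and3P[/andP[/ltW xz _] _ _] /IH; apply: le_trans.
Qed.

Lemma climb_path m x s : path (@covered _ P) x s -> all (fun z => m <= pi z)%N (x :: s) ->
  climb m x (last x s).
Proof.
move=> ps /= /andP[mx ms]; rewrite /climb mx; apply/connectP; exists s => //.
elim: s x mx ps ms => //= z s IH x mx /andP[-> ps] /andP[mz ms].
by rewrite mx mz IH.
Qed.

Let e_sym := @cover_edge_sym _ P.

Lemma up_unique a u u' : phi u = phi u' -> climb (pi u) a u -> climb (pi u') a u' -> u = u'.
Proof.
move=> E /climb_walk w /climb_walk w'; apply: (col E).
apply: (@high_walkW _ _ _ (minn (pi u) (pi u')) _ (h + h) _ _ _ (leqnn _) (leq_addr _ _)).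
apply: (high_walk_cat (y := a)).
  by apply: high_walk_sym => //; apply: high_walkW w; rewrite ?geq_minl.
by apply: high_walkW w'; rewrite ?geq_minr.
Qed.

Lemma down_unique b v v' : phi v = phi v' -> climb (pi v) v b -> climb (pi v') v' b -> v = v'.
Proof.
move=> E /climb_walk w /climb_walk w'; apply: (col E).
apply: (@high_walkW _ _ _ (minn (pi v) (pi v')) _ (h + h) _ _ _ (leqnn _) (leq_addr _ _)).
apply: (high_walk_cat (y := b)).
  by apply: high_walkW w; rewrite ?geq_minl.
by apply: high_walk_sym => //; apply: high_walkW w'; rewrite ?geq_minr.
Qed.

(** Three chains are concatenated here: from [u] down to [a], up to [b], down to
[v]. This is why walks of length [3 * h] have to be considered. *)
Lemma across_unique m a b u v : phi u = phi v -> climb m a b ->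
  climb (pi u) a u -> climb (pi v) v b -> (minn (pi u) (pi v) <= m)%N -> u = v.
Proof.
move=> E /climb_walk wab /climb_walk wu /climb_walk wv lem; apply: (col E).
apply: (high_walk_cat (y := b)); last first.
  by apply: high_walk_sym => //; apply: high_walkW wv; rewrite ?geq_minr.
apply: (high_walk_cat (y := a)); last exact: high_walkW wab.
by apply: high_walk_sym => //; apply: high_walkW wu; rewrite ?geq_minl.
Qed.

(** In an alternating cycle the critical vertex is above [a] for one pair and
below [b] for the next one. The first two bits make every pair with the same
signature see a vertex of its colour on both sides, which is what gives the
comparison in the third bit a meaning. *)
Definition signature (p : P * P) : {ffun 'I_c -> bool * bool * bool} :=
  [ffun i => ([exists u, (phi u == i) && climb (pi u) p.1 u],
    [exists v, (phi v == i) && climb (pi v) v p.2],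
    [exists u, exists v, [&& phi u == i, phi v == i, climb (pi u) p.1 u,
       climb (pi v) v p.2 & (pi u < pi v)%N]])].

(** On an alternating cycle [a_i <= b_(i+1)], choose chains of covers from [a_i] to
[b_(i+1)], and let [q] be the [pi]-least vertex on all of them, say on the chain
from [a_j]. In the colour of [q], the pair [j] has the upper vertex [u_j = q] and
the pair [j+1] has the lower vertex [v_(j+1) = q]; by equality of signatures,
every pair has both an upper vertex [u_i] and a lower vertex [v_i]. They differ,
as [a_i] is not below [b_i], and they compare in [pi] in the same way for all
[i]. If always [u_i < v_i], then [u_(j+1) < v_(j+1) = q]; and if [u_i < q], then
the walk from [u_i] through [a_i] and [b_(i+1)] to [v_(i+1)] is lowest at one of
its ends, so [v_(i+1) = u_i] and [u_(i+1) < u_i < q]. Going once around the cycle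
yields [u_j < q], a contradiction. If always [v_i < u_i], the same argument runs
around the cycle backwards. *)
Lemma signature_acyclic sg s : s != [::] ->
  all (fun p => ~~ (p.1 <= p.2) && (signature p == sg)) s ->
  ~~ cycle (fun p q => p.1 <= q.2) s.
Proof.
case: s => // p0 t _; set s := p0 :: t; set k := size s => /allP Cs.
apply/negP => cyc.
(* The cycle is unrolled into a periodic sequence. *)
pose p i := nth p0 s (i %% k).
pose a i := (p i).1; pose b i := (p i).2.
have ps i : p i \in s by apply: mem_nth; rewrite ltn_mod.
have pk i : p (i + k)%N = p i by rewrite /p modnDr.
have pmod i : p (i %% k)%N = p i by rewrite /p modn_mod.
have pSmod i : p (i %% k).+1 = p i.+1 by rewrite /p -addn1 modnDml addn1.
have ab i : a i <= b i.+1.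
  rewrite /a /b -pSmod -(pmod i).
  have : (i %% k < k)%N by rewrite ltn_mod.
  move: (i %% k)%N => r ltr; rewrite {1}/p modn_small // /p.
  move/(pathP p0)/(_ r): cyc; rewrite size_rcons => /(_ ltr).
  rewrite -rcons_cons !nth_rcons -/s -/k ltr.
  case: ltngtP => [lt|gt|->]; first by rewrite modn_small.
    by move: ltr; rewrite /k /= ltnS leqNgt gt.
  by rewrite modnn.
have nab i : ~~ (a i <= b i) by have /andP[] := Cs _ (ps i).
have sgE i : signature (p i) = sg by have /andP[_ /eqP] := Cs _ (ps i).
have /fin_all_exists[ch Hch] (xy : P * P) : exists s, xy.1 <= xy.2 ->
    path (@covered _ P) xy.1 s /\ xy.2 = last xy.1 s.
  have [/covered_connect/connectP[r pr lr]|_] := boolP (xy.1 <= xy.2); last by exists [::].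
  by exists r.
pose chain i := a i :: ch (a i, b i.+1).
have chainP i : path (@covered _ P) (a i) (ch (a i, b i.+1)) /\
    b i.+1 = last (a i) (ch (a i, b i.+1)) := Hch (a i, b i.+1) (ab i).
have [q [j [qj qmin]]] : exists q j, q \in chain j /\
    forall i z, z \in chain i -> (pi q <= pi z)%N.
  have Q0 : a 0%N \in [pred z | [exists i : 'I_k, z \in chain i]].
    by apply/existsP; exists (Ordinal (isT : 0 < k)%N); rewrite /chain mem_head.
  case: (arg_minnP pi Q0) => q /existsP[j qj] qmin; exists q, (j : nat); split=> // i z zi.
  apply: qmin; apply/existsP; exists (Ordinal (ltn_pmod i (isT : 0 < k)%N)).
  by rewrite /chain /a /b /= pSmod pmod.
have F3 i : climb (pi q) (a i) (b i.+1).
  have [pc ->] := chainP i; apply: climb_path => //; apply/allP; exact: qmin.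
have [F1 F2] : climb (pi q) (a j) q /\ climb (pi q) q (b j.+1).
  have [] := chainP j; have : all (fun z => pi q <= pi z)%N (chain j).
    by apply/allP; apply: qmin.
  move: qj; rewrite /chain inE => /predU1P[E all1 pc lc|].
    by split; [rewrite -E /climb leqnn connect0 | rewrite {2}E F3].
  case/splitPr => s1 s2; rewrite -cat_rcons -cat_cons all_cat => /andP[all1 all2].
  rewrite cat_path last_cat !last_rcons => /andP[pc1 pc2] ->; split.
    by rewrite -[X in climb _ _ X](last_rcons (a j) s1 q); apply: climb_path.
  by apply: climb_path; rewrite //= leqnn.
pose UV i u v := [/\ phi u = phi q, phi v = phi q, climb (pi u) (a i) u & climb (pi v) v (b i)].
have sg1 : (sg (phi q)).1.1.
  by rewrite -(sgE j) ffunE; apply/existsP; exists q; rewrite eqxx.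
have sg2 : (sg (phi q)).1.2.
  by rewrite -(sgE j.+1) ffunE; apply/existsP; exists q; rewrite eqxx.
have UVex i : exists u v, UV i u v.
  move: sg1 sg2; rewrite -(sgE i) ffunE /=.
  by move=> /existsP[u /andP[/eqP Eu cu]] /existsP[v /andP[/eqP Ev cv]]; exists u, v.
have UVne i u v : UV i u v -> u != v.
  case=> _ _ /climb_le au /climb_le vb; apply: contraNneq (nab i) => E.
  by apply: le_trans au _; rewrite E.
have [sg3|sg3] := boolP (sg (phi q)).2.
  have step i : exists u v, UV i u v /\ (pi u < pi v)%N.
    move: sg3; rewrite -(sgE i) ffunE /=.
    by case/existsP=> u /existsP[v /and5P[/eqP ? /eqP ? ? ? ?]]; exists u, v.
  have desc m u : phi u = phi q -> climb (pi u) (a (j + m.+1)%N) u -> (pi u < pi q)%N.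
    elim: m u => [|m IH] u Eu cu.
      have [u' [v' [[Eu' Ev' cu' cv'] lt]]] := step (j + 1)%N.
      have <- : v' = q by rewrite addn1 in cv'; apply: down_unique cv' F2.
      by rewrite (up_unique _ cu cu') // Eu Eu'.
    have [u' [v' [[Eu' Ev' cu' cv'] lt]]] := step (j + m.+2)%N.
    have [u0 [v0 [Eu0 Ev0 cu0 cv0]]] := UVex (j + m.+1)%N.
    have lt0 := IH _ Eu0 cu0.
    have E : u0 = v'.
      rewrite addnS in cv'; apply: (across_unique _ (F3 _) cu0 cv'); first by rewrite Eu0.
      by rewrite geq_min (ltnW lt0).
    by rewrite (up_unique _ cu cu') ?Eu // (ltn_trans lt) // -E.
  by have := desc (size t) q erefl; rewrite -[(size t).+1]/k /a pk ltnn => /(_ F1).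
have step i : exists u v, UV i u v /\ (pi v < pi u)%N.
  have [u [v uv]] := UVex i; exists u, v; split=> //; have nuv := UVne _ _ _ uv.
  rewrite ltn_neqAle (inj_eq pi_inj) eq_sym nuv leqNgt; apply: contra sg3 => lt.
  rewrite -(sgE i) ffunE /=; apply/existsP; exists u; apply/existsP; exists v.
  by case: uv => -> -> -> ->; rewrite eqxx.
have desc m v : (m < k)%N -> phi v = phi q -> climb (pi v) v (b (j + (k - m))%N) ->
    (pi v < pi q)%N.
  elim: m v => [|m IH] v ltm Ev cv.
    rewrite subn0 /b pk in cv.
    have [u' [v' [[Eu' Ev' cu' cv'] lt]]] := step j.
    have <- : u' = q by apply: up_unique cu' F1.
    by rewrite (down_unique _ cv cv') // Ev Ev'.
  have [u' [v' [[Eu' Ev' cu' cv'] lt]]] := step (j + (k - m.+1))%N.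
  have [u0 [v0 [Eu0 Ev0 cu0 cv0]]] := UVex (j + (k - m))%N.
  have lt0 := IH _ (ltnW ltm) Ev0 cv0.
  have E : u' = v0.
    have Ekm : (j + (k - m) = (j + (k - m.+1)).+1)%N.
      by rewrite -addnS -subSn ?subSS // ltnW.
    rewrite Ekm in cv0; apply: (across_unique _ (F3 _) cu' cv0); first by rewrite Eu'.
    by rewrite geq_min (ltnW lt0) orbT.
  by rewrite (down_unique _ cv cv') ?Ev // (ltn_trans lt) // E.
have := desc (size t) q (leqnn _) erefl; rewrite -[k]/(size t).+1 subSnn addn1.
by rewrite ltnn => /(_ F2).
Qed.

End Signature.
End PosetDim.

(** * From connecting sets to subdivisions *)

Lemma prefix_map (S T : eqType) (f : S -> T) : injective f ->
  forall s1 s2, prefix (map f s1) (map f s2) = prefix s1 s2.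
Proof. by move=> inj; elim=> [|x s1 IH] [|y s2] //=; rewrite inj_eq // IH. Qed.

Lemma infix_map (S T : eqType) (f : S -> T) : injective f ->
  forall s1 s2, infix (map f s1) (map f s2) = infix s1 s2.
Proof.
move=> inj s1; elim=> [|y s2 IH] /=; first by case: s1.
by have /= -> := prefix_map inj s1 (y :: s2); rewrite IH.
Qed.

(** Turns the edge relation of a union of paths, which is defined through
consecutive pairs, into sortedness of each path. *)
Lemma sorted_infix2 (T : eqType) (r : rel T) (s : seq T) :
  (forall x y, infix [:: x; y] s -> r x y) -> sorted r s.
Proof.
elim: s => [|x [|y s] IH] // adj; apply/andP; split.
  by apply: adj; apply: (infix_infix [::] [:: x; y] s).
by apply: IH => u v uv; apply: adj; apply: (infix_catl [:: x] uv).
Qed.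

Section SubdivisionOfPaths.
Variables (G : sgraph) (n : nat) (f : 'I_n -> G) (q : 'I_n -> 'I_n -> seq G).
Let pth u v := f u :: rcons (q u v) (f v).
Hypotheses (f_inj : injective f)
  (q_rev : forall u v, u != v -> q v u = rev (q u v))
  (q_path : forall u v, u != v -> sorted (@edge G) (pth u v))
  (q_uniq : forall u v, u != v -> uniq (pth u v))
  (q_avoid : forall u v w, u != v -> f w \notin q u v)
  (q_disj : forall u v u' v', u != v -> u' != v' ->
     (u', v') <> (u, v) -> (u', v') <> (v, u) ->
     forall x, x \in q u v -> x \notin q u' v').

Let used : {set G} := [set x | [exists u, x == f u] ||
  [exists u, exists v, (u != v) && (x \in q u v)]].

Let V' : finType := {x : G | x \in used}.

(** The subgraph of [G] made of the given paths and nothing else. *)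
Let adj : rel V' := fun x y =>
  [exists u, exists v, (u != v) && infix [:: val x; val y] (pth u v)].

Let pth_rev u v : u != v -> pth v u = rev (pth u v).
Proof. by move=> uv; rewrite /pth q_rev // rev_cons rev_rcons rcons_cons. Qed.

Let adj_sym : symmetric adj.
Proof.
suff imp x y : adj x y -> adj y x by move=> x y; apply/idP/idP; apply: imp.
case/existsP=> u /existsP[v /andP[uv xy]].
apply/existsP; exists v; apply/existsP; exists u; rewrite eq_sym uv.
by rewrite pth_rev // -infix_revLR.
Qed.

Let adj_irr : irreflexive adj.
Proof.
move=> x; apply/negbTE/negP; case/existsP=> u /existsP[v /andP[uv xx]].
by have := infix_uniq xx (q_uniq uv); rewrite /= inE eqxx.
Qed.

Lemma paths_topological_minor : topological_minor (complete_graph n) G.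
Proof.
have f_used u : f u \in used.
  by rewrite inE; apply/orP; left; apply/existsP; exists u.
pose b u : V' := Sub (f u) (f_used u).
pose qq u v : seq V' := pmap insub (q u v).
have qqE u v : u != v -> map val (qq u v) = q u v.
  move=> uv; rewrite pmap_filter; last exact: insubK.
  apply/all_filterP/allP => x xq /=; rewrite isSome_insub inE.
  by apply/orP; right; apply/existsP; exists u; apply/existsP; exists v; rewrite uv.
have mem_qq u v (x : V') : u != v -> (x \in qq u v) = (val x \in q u v).
  by move=> uv; rewrite -qqE // mem_map //; apply: val_inj.
pose H' := SGraph adj_sym adj_irr.
have pathE u v : u != v ->
    map val (@subdiv_path (complete_graph n) H' b qq u v) = pth u v.
  by move=> uv; rewrite /subdiv_path /= map_rcons qqE.
exists H'; last first.
  exists (val : H' -> G); first exact: val_inj.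
  move=> x y /existsP[u /existsP[v /andP[uv xy]]].
  by have := infix_sorted xy (q_path uv); rewrite /= andbT.
exists b, qq; split.
- by move=> u v /(congr1 val) /f_inj.
- move=> u v edge_uv; have uv : u != v := edge_uv; split.
  + have : map val (qq v u) = map val (rev (qq u v)).
      have vu : v != u by rewrite eq_sym.
      rewrite map_rev.
      rewrite (qqE _ _ uv).
      rewrite (qqE _ _ vu).
      exact: q_rev.
    exact: (@inj_map V' G val val_inj).
  + apply: sorted_infix2 => x y xy; apply/existsP; exists u; apply/existsP; exists v.
    by rewrite uv -(pathE _ _ uv) (@infix_map V' G val val_inj [:: x; y]).
  + by rewrite -(@map_inj_uniq V' G val val_inj) (pathE _ _ uv) q_uniq.
  + by move=> w; rewrite (mem_qq _ _ _ uv); apply: q_avoid.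
- move=> u v u' v' edge_uv edge_uv' n1 n2 x.
  by rewrite (mem_qq _ _ _ edge_uv) (mem_qq _ _ _ edge_uv'); apply: q_disj.
- move=> x; have := valP x; rewrite inE.
  case/orP => /existsP[u]; first by move/eqP=> xu; left; exists u; apply: val_inj.
  by case/existsP=> v /andP[uv xq]; right; exists u, v; split; rewrite ?(mem_qq _ _ _ uv).
- move=> x y /existsP[u /existsP[v /andP[uv xy]]]; exists u, v; split=> //.
  by rewrite -(infix_map val_inj) (pathE _ _ uv).
Qed.

End SubdivisionOfPaths.

Lemma linked_uniq (T : finType) (e : rel T) (A : {set T}) x y :
  x != y -> linked e A x y -> exists s,
    [/\ path e x (rcons s y), uniq (x :: rcons s y) & {subset s <= A}].
Proof.
move=> xy [s ps sA]; have := last_rcons x s y.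
case/shortenP: ps => t; case/lastP: t => [|t z] pt ut sub; first by move=> E; case/eqP: xy.
rewrite last_rcons => E; move: pt ut sub; rewrite E => pt ut sub.
exists t; split=> // w wt; have := sub w; rewrite !mem_rcons !inE wt orbT => /(_ isT).
case/predU1P => [Ew|]; last exact: sA.
by move: ut; rewrite /= rcons_uniq -Ew wt andbF.
Qed.

(** The paths are chosen for [u < v] and reversed for the other orientation. *)
Lemma clique_topological_minor (G : sgraph) n :
  has_clique (@edge G) n setT -> topological_minor (complete_graph n) G.
Proof.
case=> f [Q [[f_inj _] Ql _ Qf Qd]].
have {}f_inj : injective f by move=> u v; apply: f_inj; rewrite inE.
have /fin_all_exists[s Hs] (p : 'I_n * 'I_n) : exists s, p.1 < p.2 ->
    [/\ path (@edge G) (f p.1) (rcons s (f p.2)), uniq (f p.1 :: rcons s (f p.2))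
      & {subset s <= Q p.1 p.2}].
  case: p => u v /=; case: (ltnP u v) => [uv|_]; last by exists [::].
  have nuv : f u != f v by rewrite (inj_eq f_inj) -val_eqE neq_ltn uv.
  by have [s ?] := linked_uniq nuv (Ql u v (in_setT u) (in_setT v) uv); exists s.
pose q (u v : 'I_n) := if u < v then s (u, v) else rev (s (v, u)).
pose lo (u v : 'I_n) := if u < v then (u, v) else (v, u).
have lo_lt (u v : 'I_n) : u != v -> (lo u v).1 < (lo u v).2.
  by rewrite -val_eqE neq_ltn /lo => /=; case: ifP => //= _.
have q_rev (u v : 'I_n) : u != v -> q v u = rev (q u v).
  by rewrite -val_eqE /q /=; case: (ltngtP u v) => //; rewrite revK.
have q_lo (u v : 'I_n) x : u != v -> x \in q u v -> x \in Q (lo u v).1 (lo u v).2.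
  move=> /lo_lt uv; have [_ _ sub] := Hs _ uv; move: uv sub; rewrite /q /lo.
  by case: ifP => _ /= _ sub; rewrite ?mem_rev; apply: sub.
apply: (@paths_topological_minor G n f q) => //.
- move=> u v uv; have [] := Hs _ (lo_lt _ _ uv); rewrite /q /lo; case: ifP => _ //= ps _ _.
  by rewrite -path_rev_rcons //; apply: edge_sym.
- move=> u v uv; have [_] := Hs _ (lo_lt _ _ uv); rewrite /q /lo; case: ifP => _ // us _.
  by rewrite -rev_uniq rev_cons rev_rcons revK.
- move=> u v w uv; apply/negP => /(q_lo _ _ _ uv); apply/negP/Qf; rewrite ?inE //.
  exact: lo_lt.
- move=> u v u' v' uv uv' n1 n2 x /(q_lo _ _ _ uv) xQ; apply/negP => /(q_lo _ _ _ uv') xQ'.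
  have := Qd _ _ _ _ (in_setT _) (in_setT _) (in_setT _) (in_setT _) (lo_lt _ _ uv) (lo_lt _ _ uv') x xQ xQ'.
  have : (u', v') != (u, v) by apply/eqP.
  have : (u', v') != (v, u) by apply/eqP.
  rewrite !xpair_eqE /lo; case: ifP; case: ifP => _ _ /=;
    by case: (u' == u); case: (v' == v); case: (u' == v); case: (v' == u).
Qed.

Theorem theorem1 (h n : nat) (h_gt0 : 0 < h) (n_gt0 : 0 < n) :
  exists d : nat, forall (disp : Order.disp_t) (P : finPOrderType disp),
    height P <= h ->
    ~ topological_minor (complete_graph n) (cover_graph P) ->
    dim P <= d.
Proof.
exists #|{ffun 'I_(color_bound n (h + h + h)) -> bool * bool * bool}|.
move=> disp P hP noK.
have noK' : ~ has_clique (@cover_edge _ P) n setT.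
  by move=> K; apply: noK; exact: (@clique_topological_minor (cover_graph P)).
have [pi [phi [pi_inj col]]] := weak_coloring (h + h + h) (@cover_edge_sym _ P) n_gt0 noK'.
exact: dim_signature (signature_acyclic hP pi_inj col).
Qed.
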